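(* Let $\mathbf{k}$ be a field, let $(A^\bullet,m_A,d_A)$ be a 2-dga over $\mathbf{k}$, let $\mathcal{R}$ be a finite dimensional commutative local $\mathbf{k}$-algebra with maximal ideal $\mathcal{R}_+$ and $\mathcal{R}/\mathcal{R}_+\cong\mathbf{k}$, and let $N\ge2$ be an integer. Let $e\in Der(A^\bullet\otimes\mathcal{R}_+)$ be of degree 1. Then $A^\bullet_{\mathcal R}=A^\bullet\otimes\mathcal{R}$, with differential $d_{A_{\mathcal R}}=d_A+e$, is an $N$-deformation of $A^\bullet$ over $\mathcal{R}$ if and only if $e$ satisfies $$(d_{End}(e)+e^2)^{\frac{N-1}{2}}(d_A+e)=0\quad\text{if } N \text{ is odd},$$ $$(d_{End}(e)+e^2)^{\frac{N}{2}}=0\quad\text{if } N \text{ is even}.$$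
   Context: An $N$-dga over a commutative ring is a triple $(A^\bullet,m,d)$ where $(A^\bullet=\bigoplus_{i\in\mathbb{Z}}A^i,m)$ is a graded associative algebra and $d$ is a linear map of degree $1$ with $d(ab)=d(a)b+(-1)^{\bar a}a\,d(b)$ (where $\bar a$ is the degree of $a$) and $d^N=0$; every 2-dga is an $N$-dga for $N\ge2$. An $N$-deformation of an $M$-dga $A^\bullet$ over $\mathcal{R}$ ($N\ge M$) is an $N$-dga $A^\bullet_{\mathcal R}$ over $\mathcal{R}$ such that $A^\bullet_{\mathcal R}/\mathcal{R}_+A^\bullet_{\mathcal R}$ is isomorphic to $A^\bullet$ as an $N$-dga. Here $A^\bullet\otimes\mathcal{R}$ carries the $\mathcal{R}$-bilinear extension of the product of $A^\bullet$, and $d_A$ is extended $\mathcal{R}$-linearly. ''$e\in Der(A^\bullet\otimes\mathcal{R}_+)$ of degree 1'' means: $e$ is an $\mathcal{R}$-linear map $A^\bullet\otimes\mathcal{R}\to A^\bullet\otimes\mathcal{R}$ of degree $1$, with image in $A^\bullet\otimes\mathcal{R}_+$, satisfying $e(ab)=e(a)b+(-1)^{\bar a}a\,e(b)$. For a homogeneous endomorphism $f$, $d_{End}(f)=d_A\circ f-(-1)^{\bar f}f\circ d_A$; in particular $d_{End}(e)=d_Ae+ed_A$. Products of endomorphisms are compositions. *)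

(* Defs.v *)
From HB Require Import structures.
From mathcomp Require Import all_boot all_order all_algebra falgebra.
From mathcomp Require Import boolp.

Set Implicit Arguments.
Unset Strict Implicit.
Unset Printing Implicit Defensive.

Import GRing.Theory.
Local Open Scope ring_scope.
Local Open Scope quotient_scope.

(* Algebras are associative but not required to be unital: they are modules   *)
(* with a product, and gradings are internal (a family of submodules). A      *)
(* [predga] carries only the data; the axioms are in [ndga].                  *)
Record predga (K : comNzRingType) : Type := Predga {
  dga_sort :> lmodType K;
  dga_mul : dga_sort -> dga_sort -> dga_sort;
  dga_gr : int -> dga_sort -> Prop;
  dga_d : dga_sort -> dga_sort
}.

Section NDga.
Variables (K : comNzRingType) (A : predga K).

Definition bilinear_mul : Prop :=
  (forall a, linear (@dga_mul K A a)) /\ (forall b, linear ((@dga_mul K A)^~ b)).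

Definition graded_module : Prop :=
  [/\ forall i, dga_gr i (0 : A),
      forall i (c : K) (x y : A),
        dga_gr i x -> dga_gr i y -> dga_gr i (c *: x + y),
      forall x : A, exists (s : seq int) (f : int -> A),
        [/\ uniq s, forall i, dga_gr i (f i) & x = \sum_(i <- s) f i]
    & forall (s : seq int) (f : int -> A), uniq s ->
        (forall i, dga_gr i (f i)) -> \sum_(i <- s) f i = 0 ->
        {in s, forall i, f i = 0}].

Definition graded_algebra : Prop :=
  [/\ graded_module,
      bilinear_mul,
      associative (@dga_mul K A)
    & forall i j (a b : A),
        dga_gr i a -> dga_gr j b -> dga_gr (i + j) (dga_mul a b)].

Definition homog_of_degree (p : int) (f : A -> A) : Prop :=
  forall i (a : A), dga_gr i a -> dga_gr (i + p) (f a).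

(* (-1)^i only depends on the parity of i, i.e. of `|i|. *)
Definition leibniz1 (f : A -> A) : Prop :=
  forall i (a b : A), dga_gr i a ->
    f (dga_mul a b) = dga_mul (f a) b + (-1) ^+ `|i|%N *: dga_mul a (f b).

Definition ndga (N : nat) : Prop :=
  [/\ graded_algebra,
      linear (@dga_d K A),
      homog_of_degree 1 (@dga_d K A),
      leibniz1 (@dga_d K A)
    & forall a : A, iter N (@dga_d K A) a = 0].

Definition dEnd (p : int) (f : A -> A) (a : A) : A :=
  dga_d (f a) - (-1) ^+ `|p|%N *: f (dga_d a).

Definition add_diff (e : A -> A) : predga K :=
  Predga (@dga_mul K A) (@dga_gr K A) (@dga_d K A \+ e).

Lemma ndga_leq (M N : nat) : (M <= N)%N -> ndga M -> ndga N.
Proof.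
move=> leMN [gA lind degd leib dM]; split=> // a.
have d0 : dga_d (0 : A) = 0.
  by have := lind (-1) 0 0; rewrite scaler0 addr0 scaleN1r addNr.
have it0 n : iter n (@dga_d K A) 0 = 0 by elim: n => //= n ->.
by rewrite -(subnK leMN) iterD dM it0.
Qed.

End NDga.

Definition dga_iso (K : comNzRingType) (A B : predga K) : Prop :=
  exists phi : {linear A -> B},
    [/\ bijective phi,
        forall x y, phi (dga_mul x y) = dga_mul (phi x) (phi y),
        forall i x, dga_gr i x <-> dga_gr i (phi x)
      & forall x, phi (dga_d x) = dga_d (phi x)].

#[short(type="comFalgType")]
HB.structure Definition ComFalgebra (K : nzRingType) :=
  { R of Falgebra K R & GRing.ComUnitAlgebra K R }.

(* [idealr R] is the type of proper ideals of R. *)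
Definition maximal_ideal (R : comNzRingType) (I : idealr R) : Prop :=
  forall J : idealr R, {subset I <= J} -> J =i I.

Definition local_with (R : comNzRingType) (Rp : idealr R) : Prop :=
  maximal_ideal Rp /\ forall I : idealr R, maximal_ideal I -> I =i Rp.

(* The isomorphism is one of k-algebras: phi sends the class of c%:A to c. *)
Definition residue_field_is (k : fieldType) (R : comFalgType k)
    (Rp : idealr R) : Prop :=
  exists phi : {rmorphism {ideal_quot Rp} -> k},
    bijective phi /\ forall c : k, phi (\pi_({ideal_quot Rp}) c%:A) = c.

Section IdealAction.
Variables (R : comNzRingType) (I : idealr R) (V : lmodType R).

Definition ideal_act (x : V) : bool :=
  `[< exists (n : nat) (r : 'I_n -> R) (v : 'I_n -> V),
        (forall i, r i \in I) /\ x = \sum_(i < n) r i *: v i >].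

Fact ideal_act_zmod : zmod_closed ideal_act.
Proof.
split.
  apply/asboolP; exists 0%N, (fun=> 0), (fun=> 0).
  by split=> [[]|] //; rewrite big_ord0.
move=> x y /asboolP[n [r [v [rI ->]]]] /asboolP[m [s [w [sI ->]]]].
apply/asboolP; exists (n + m)%N.
exists (fun i => match split i with inl j => r j | inr j => s j end).
exists (fun i => match split i with inl j => v j | inr j => - w j end).
split=> [i|]; first by case: (split i).
rewrite big_split_ord /= -sumrN; congr (_ + _); apply: eq_bigr => i _.
  by rewrite (unsplitK (inl _ i)).
by rewrite (unsplitK (inr _ i)) scalerN.
Qed.

HB.instance Definition _ := GRing.isZmodClosed.Build V ideal_act ideal_act_zmod.
Definition ideal_smod : zmodClosed V := GRing.ZmodClosed.clone V ideal_act _.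

Lemma ideal_actZ (c : R) (x : V) : ideal_act x -> ideal_act (c *: x).
Proof.
move=> /asboolP[n [r [v [rI ->]]]]; apply/asboolP.
exists n, (fun i => c * r i), v; split=> [i|]; first exact: idealMr.
by rewrite scaler_sumr; apply: eq_bigr => i _; rewrite scalerA.
Qed.

End IdealAction.

(* V / IV, for an R-module V over a k-algebra R, as a k-module. *)
Section Reduction.
Variables (k : comNzRingType) (R : comAlgType k) (I : idealr R).
Variable V : lmodType R.

Definition red : Type := @Quotient.quot V (ideal_smod I V).
HB.instance Definition _ := GRing.Zmodule.on red.

Definition red_pi (x : V) : red := \pi_(@Quotient.quot V (ideal_smod I V)) x.
Definition red_repr (x : red) : V :=
  repr (x : @Quotient.quot V (ideal_smod I V)).

Lemma red_reprK : cancel red_repr red_pi.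
Proof. exact: reprK. Qed.

Lemma red_piP (x y : V) : red_pi x = red_pi y <-> ideal_act I (x - y).
Proof.
split=> [h|h].
  by change (is_true (x - y \in ideal_smod I V)); rewrite Quotient.idealrBE; exact/eqP.
by apply/eqP; rewrite -(Quotient.idealrBE (ideal_smod I V)).
Qed.

Lemma red_piD (x y : V) : red_pi (x + y) = red_pi x + red_pi y.
Proof. exact: raddfD. Qed.

Definition red_scale (c : k) (x : red) : red := red_pi (c%:A *: red_repr x).

Lemma red_scale_pi (c : k) (x : V) : red_scale c (red_pi x) = red_pi (c%:A *: x).
Proof.
apply/red_piP; rewrite -scalerBr; apply: ideal_actZ.
by apply/red_piP; rewrite red_reprK.
Qed.

Fact red_scaleA a b x : red_scale a (red_scale b x) = red_scale (a * b) x.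
Proof.
by rewrite -[x]red_reprK !red_scale_pi scalerA -scalerAl mul1r scalerA.
Qed.

Fact red_scale1 : left_id 1 red_scale.
Proof. by move=> x; rewrite -[x]red_reprK red_scale_pi !scale1r. Qed.

Fact red_scaleDr : right_distributive red_scale +%R.
Proof.
move=> c x y; rewrite -[x]red_reprK -[y]red_reprK -red_piD !red_scale_pi.
by rewrite scalerDr red_piD.
Qed.

Fact red_scaleDl x : {morph red_scale^~ x : a b / a + b}.
Proof.
by move=> a b; rewrite -[x]red_reprK !red_scale_pi !scalerDl red_piD.
Qed.

HB.instance Definition _ := GRing.Zmodule_isLmodule.Build k red
  red_scaleA red_scale1 red_scaleDr red_scaleDl.

End Reduction.

(* B / IB with the induced structure, defined on representatives; it is       *)
(* independent of them as soon as the product and the differential of B are   *)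
(* R-(bi)linear, see [red_mul_pi] and [red_d_pi].                             *)
Definition red_dga (k : comNzRingType) (R : comAlgType k) (I : idealr R)
    (B : predga R) : predga k :=
  @Predga k (red I B)
    (fun x y => red_pi I (dga_mul (red_repr x) (red_repr y)))
    (fun i x => exists2 y : B, dga_gr i y & x = red_pi I y)
    (fun x => red_pi I (dga_d (red_repr x))).

Section ReductionFacts.
Variables (k : comNzRingType) (R : comAlgType k) (I : idealr R) (B : predga R).

Let linear_ideal_act (f : B -> B) :
  linear f -> forall x y, ideal_act I (x - y) -> ideal_act I (f x - f y).
Proof.
move=> linf x y xy.
have fB u v : f (u - v) = f u - f v.
  by have := linf (-1) v u; rewrite !scaleN1r ![- _ + _]addrC.
have f0 : f 0 = 0 by have := fB 0 0; rewrite !subrr.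
rewrite -fB; case/asboolP: xy => n [r [v [rI ->]]].
apply/asboolP; exists n, r, (f \o v); split=> //=.
apply: (big_ind2 (fun a b => f a = b)) => // [a a' b b' <- <-|i _].
  by have := linf 1 a b; rewrite !scale1r.
by have := linf (r i) (v i) 0; rewrite f0 !addr0.
Qed.

Lemma red_d_pi (x : B) : linear (@dga_d R B) ->
  dga_d (red_pi I x : red_dga I B) = red_pi I (dga_d x).
Proof.
move=> lind; apply/(red_piP (k := k)); apply: (linear_ideal_act lind).
by apply/(red_piP (k := k)); rewrite red_reprK.
Qed.

Lemma red_mul_pi (x y : B) : bilinear_mul B ->
  dga_mul (red_pi I x : red_dga I B) (red_pi I y) = red_pi I (dga_mul x y).
Proof.
move=> [linl linr]; set x' := red_repr (red_pi I x); set y' := red_repr (red_pi I y).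
transitivity (red_pi I (dga_mul x' y)); apply/(red_piP (k := k)).
  by apply: linear_ideal_act (linl x') _ _ _; apply/(red_piP (k := k)); rewrite red_reprK.
by apply: linear_ideal_act (linr y) _ _ _; apply/(red_piP (k := k)); rewrite red_reprK.
Qed.

End ReductionFacts.

Definition N_deformation (k : comNzRingType) (R : comAlgType k) (Rp : idealr R)
    (N : nat) (A : predga k) (B : predga R) : Prop :=
  ndga B N /\ dga_iso (red_dga Rp B) A.

(* V (x) R for a finite dimensional R, in coordinates on the basis            *)
(* [vbasis {:R}] of R: the family (v_i)_i stands for \sum_i v_i (x) b_i.      *)
(* [tens_univ] is the universal property.                                     *)
Section Tensor.
Variables (k : fieldType) (V : lmodType k) (R : comFalgType k).

Local Notation n := (\dim {:R}).
Local Notation b i := ((vbasis {:R})`_i).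
Local Notation co i r := (coord (vbasis {:R}) i r).

Definition tens : Type := {ffun 'I_n -> V}.
HB.instance Definition _ := GRing.Zmodule.on tens.

Definition tpure (v : V) (r : R) : tens := [ffun i => co i r *: v].

Lemma tpure_sumr (I : finType) v (F : I -> R) :
  tpure v (\sum_i F i) = \sum_i tpure v (F i).
Proof.
by apply/ffunP=> j; rewrite ffunE sum_ffunE linear_sum scaler_suml;
  apply: eq_bigr => i _; rewrite ffunE.
Qed.

Lemma tpure_suml (I : finType) (F : I -> V) r :
  tpure (\sum_i F i) r = \sum_i tpure (F i) r.
Proof.
by apply/ffunP=> j; rewrite ffunE sum_ffunE scaler_sumr;
  apply: eq_bigr => i _; rewrite ffunE.
Qed.

Lemma tpureZ (c : k) v r : tpure (c *: v) r = tpure v (c *: r).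
Proof. by apply/ffunP=> j; rewrite !ffunE [coord _ _ (c *: r)]linearZ /= !scalerA [c * _]mulrC. Qed.

Lemma tpureDl u v r : tpure (u + v) r = tpure u r + tpure v r.
Proof. by apply/ffunP=> j; rewrite !ffunE scalerDr. Qed.

Lemma tpureDr v r s : tpure v (r + s) = tpure v r + tpure v s.
Proof. by apply/ffunP=> j; rewrite !ffunE linearD scalerDl. Qed.

Lemma basisE (r : R) : r = \sum_i co i r *: b i.
Proof. exact/coord_vbasis/memvf. Qed.

Lemma co_basis (i j : 'I_n) : co i (b j) = (i == j)%:R.
Proof. by rewrite coord_free ?(basis_free (vbasisP _)) // eq_sym. Qed.

Lemma tensE (x : tens) : x = \sum_i tpure (x i) (b i).
Proof.
apply/ffunP=> j; rewrite sum_ffunE (bigD1 j) //= ffunE co_basis eqxx scale1r.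
rewrite big1 ?addr0 // => i ij; rewrite ffunE co_basis eq_sym.
by rewrite (negPf ij) scale0r.
Qed.

Definition tens_scale (s : R) (x : tens) : tens := \sum_i tpure (x i) (s * b i).

Lemma tens_scale_pure s v r : tens_scale s (tpure v r) = tpure v (s * r).
Proof.
rewrite {2}(basisE r) mulr_sumr tpure_sumr; apply: eq_bigr => i _.
by rewrite ffunE tpureZ scalerAr.
Qed.

Fact tens_scaleDr : right_distributive tens_scale +%R.
Proof.
move=> s x y; rewrite -big_split; apply: eq_bigr => i _.
by rewrite ffunE tpureDl.
Qed.

Fact tens_scaleDl x : {morph tens_scale^~ x : r s / r + s}.
Proof.
move=> r s; rewrite -big_split; apply: eq_bigr => i _ /=.
by rewrite mulrDl tpureDr.
Qed.

Fact tens_scale0r s : tens_scale s 0 = 0.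
Proof. by apply: (addrI (tens_scale s 0)); rewrite -tens_scaleDr !addr0. Qed.

Fact tens_scaleA r s x : tens_scale r (tens_scale s x) = tens_scale (r * s) x.
Proof.
rewrite [tens_scale s x]/tens_scale.
rewrite (big_morph _ (tens_scaleDr r) (tens_scale0r r)).
by apply: eq_bigr => i _; rewrite tens_scale_pure mulrA.
Qed.

Fact tens_scale1 : left_id 1 tens_scale.
Proof.
by move=> x; rewrite [RHS]tensE; apply: eq_bigr => i _; rewrite mul1r.
Qed.

HB.instance Definition _ := GRing.Zmodule_isLmodule.Build R tens
  tens_scaleA tens_scale1 tens_scaleDr tens_scaleDl.

Lemma scale_tpure (s : R) v r : s *: tpure v r = tpure v (s * r).
Proof. exact: tens_scale_pure. Qed.

(* The k-module structure of [tens] is the one induced by c |-> c%:A. *)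
Lemma tens_univ (W : lmodType k) (f : V -> R -> W) :
    (forall v, linear (f v)) -> (forall r, linear (f^~ r)) ->
  exists! g : tens -> W,
    [/\ {morph g : x y / x + y}, forall (c : k) x, g (c%:A *: x) = c *: g x
      & forall v r, g (tpure v r) = f v r].
Proof.
move=> linr linl.
have fD v r s : f v (r + s) = f v r + f v s.
  by have := linr v 1 r s; rewrite !scale1r.
have f0 v : f v 0 = 0 by apply: (addrI (f v 0)); rewrite -fD !addr0.
have fZ v c r : f v (c *: r) = c *: f v r.
  by have := linr v c r 0; rewrite f0 !addr0.
have flD r u v : f (u + v) r = f u r + f v r.
  by have := linl r 1 u v; rewrite !scale1r.
have fl0 r : f 0 r = 0 by apply: (addrI (f 0 r)); rewrite -flD !addr0.
have flZ r c v : f (c *: v) r = c *: f v r.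
  by have := linl r c v 0; rewrite fl0 !addr0.
pose g (x : tens) := \sum_i f (x i) (b i).
have gD : {morph g : x y / x + y}.
  by move=> x y; rewrite -big_split; apply: eq_bigr => i _; rewrite ffunE flD.
have g0 : g 0 = 0 by apply: (addrI (g 0)); rewrite -gD !addr0.
have gp v r : g (tpure v r) = f v r.
  rewrite [in RHS](basisE r) (big_morph _ (fD v) (f0 v)).
  by apply: eq_bigr => i _; rewrite ffunE flZ fZ.
exists g; split=> [|h [hD hZ hp]].
  split=> // c x; rewrite (tensE x) scaler_sumr !(big_morph _ gD g0) scaler_sumr.
  by apply: eq_bigr => i _; rewrite scale_tpure -scalerAl mul1r !gp fZ.
have h0 : h 0 = 0 by apply: (addrI (h 0)); rewrite -hD !addr0.
apply: funext => x; rewrite (tensE x) (big_morph _ gD g0) (big_morph _ hD h0).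
by apply: eq_bigr => i _; rewrite gp hp.
Qed.

Definition tens_span (P : V -> Prop) (Q : R -> Prop) (x : tens) : Prop :=
  exists (m : nat) (v : 'I_m -> V) (r : 'I_m -> R),
    [/\ forall j, P (v j), forall j, Q (r j) & x = \sum_(j < m) tpure (v j) (r j)].

Definition tens_map (f : V -> V) (x : tens) : tens := \sum_i tpure (f (x i)) (b i).

Lemma tens_map_pure f v r : linear f -> tens_map f (tpure v r) = tpure (f v) r.
Proof.
move=> linf.
have f0 : f 0 = 0.
  by have := linf (-1) 0 0; rewrite scaler0 addr0 scaleN1r addNr.
rewrite [in RHS](basisE r) tpure_sumr; apply: eq_bigr => i _.
by rewrite ffunE -tpureZ; congr tpure; have := linf (co i r) v 0; rewrite f0 !addr0.
Qed.

Definition tens_mul (m : V -> V -> V) (x y : tens) : tens :=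
  \sum_i \sum_j tpure (m (x i) (y j)) (b i * b j).

Lemma tens_mul_pure m u v r s :
    (forall a, linear (m a)) -> (forall a, linear (m^~ a)) ->
  tens_mul m (tpure u r) (tpure v s) = tpure (m u v) (r * s).
Proof.
move=> linr linl.
have mZr a c v' : m a (c *: v') = c *: m a v'.
  have m0 : m a 0 = 0.
    by have := linr a (-1) 0 0; rewrite scaler0 addr0 scaleN1r addNr.
  by have := linr a c v' 0; rewrite m0 !addr0.
have mZl a c v' : m (c *: v') a = c *: m v' a.
  have m0 : m 0 a = 0.
    by have := linl a (-1) 0 0; rewrite scaler0 addr0 scaleN1r addNr.
  by have := linl a c v' 0; rewrite m0 !addr0.
rewrite [in RHS](basisE r) mulr_suml tpure_sumr; apply: eq_bigr => i _.
rewrite [in RHS](basisE s) mulr_sumr tpure_sumr; apply: eq_bigr => j _.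
by rewrite !ffunE mZl mZr !tpureZ -scalerAr -scalerAl.
Qed.

End Tensor.

Definition tens_dga (k : fieldType) (A : predga k) (R : comFalgType k) : predga R :=
  @Predga R (tens A R)
    (tens_mul (@dga_mul k A))
    (fun i => tens_span (dga_gr i) (fun=> True))
    (tens_map (@dga_d k A)).

(* The third clause says that e takes its values in A (x) R_+. *)
Definition der1_plus (k : fieldType) (A : predga k) (R : comFalgType k)
    (Rp : idealr R) (e : tens_dga A R -> tens_dga A R) : Prop :=
  [/\ linear e,
      homog_of_degree 1 e,
      forall x, tens_span (fun=> True) (fun r => r \in Rp) (e x)
    & leibniz1 e].

(* Main.v *)
(* Put D = d_A + e. Since d_A^2 = 0, D^2 = d_End(e) + e^2, so the displayed   *)
(* equations say exactly that D^N = 0. The other axioms of an N-dga hold for  *)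
(* D on A (x) R with no condition on e. The reduction modulo R_+ is A,        *)
(* through a (x) r |-> eps(r) a with eps : R -> R/R_+ = k: this map kills the *)
(* image of e, and modulo R_+ (A (x) R) every x is congruent to the tensor of *)
(* its image with 1.                                                          *)
Require Import Defs.
From HB Require Import structures.
From mathcomp Require Import all_boot all_order all_algebra falgebra.
From mathcomp Require Import boolp.

Import GRing.Theory.
Local Open Scope ring_scope.

(** For every admissible [e], the only condition that D = d_A + e can fail is D^N = 0. Extension of
    scalars makes A (x) R a 2-dga over [R] ([tens_ndga]), and adding a derivation of degree 1 to a
    differential preserves all axioms except possibly nilpotency ([add_diff_ndga]). The reduction
    modulo R_+ is always [A] ([add_diff_iso]): if eps : R -> k is the residue map
    ([residue_augmentation]), then a (x) r |-> eps(r) a has kernel R_+ (A (x) R) ([tens_eval_eq0]),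
    respects products, degrees and d_A, and kills the image of [e]. Finally, d_A^2 = 0 gives D^2 =
    d_End(e) + e^2, so D^N is (D^2)^(N/2) for [N] even and (D^2)^((N-1)/2) D for [N] odd. *)

(** * Unbundled linear maps and graded modules *)

Section LinearProp.
Context {K : nzRingType} {U V : lmodType K} {f : U -> V} (linf : linear f).

Lemma linear_propD : {morph f : x y / x + y}.
Proof. by move=> x y; have := linf 1 x y; rewrite !scale1r. Qed.

Lemma linear_prop0 : f 0 = 0.
Proof. by apply: (addrI (f 0)); rewrite -linear_propD !addr0. Qed.

Lemma linear_propZ (c : K) : {morph f : x / c *: x}.
Proof. by move=> x; have := linf c x 0; rewrite linear_prop0 !addr0. Qed.

Lemma linear_prop_sum (I : finType) (F : I -> U) :
  f (\sum_i F i) = \sum_i f (F i).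
Proof. exact: (big_morph f linear_propD linear_prop0). Qed.

End LinearProp.

Section GradedModule.
Context {K : comNzRingType} {A : predga K} (grA : graded_module A) (i : int).

Lemma gr_add (x y : A) : dga_gr i x -> dga_gr i y -> dga_gr i (x + y).
Proof. by have [_ grZD _ _] := grA; rewrite -{2}[x]scale1r; apply: grZD. Qed.

Lemma gr_scale c (x : A) : dga_gr i x -> dga_gr i (c *: x).
Proof.
by have [gr0 grZD _ _] := grA => xi; rewrite -[_ *: _]addr0; apply: grZD.
Qed.

Lemma gr_sum (I : finType) (F : I -> A) :
  (forall j, dga_gr i (F j)) -> dga_gr i (\sum_j F j).
Proof.
have [gr0 _ _ _] := grA => Fi.
by apply: big_ind => // x y; apply: gr_add.
Qed.

End GradedModule.

(** * Perturbing a differential by a derivation *)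

Section AddDiff.
Context {K : comNzRingType} {A : predga K} {e : A -> A}.

Lemma add_diff_linear :
  linear (@dga_d K A) -> linear e -> linear (@dga_d K (add_diff e)).
Proof. by move=> lind line c x y; rewrite /= lind line scalerDr addrACA. Qed.

(** The Leibniz rule is additive in the map, as are linearity and homogeneity of degree 1.
    Nilpotency is not, so it is assumed for the sum. *)
Lemma add_diff_ndga M N : ndga A M ->
    linear e -> homog_of_degree 1 e -> leibniz1 e ->
    (forall x, iter N (@dga_d K A \+ e) x = 0) ->
  ndga (add_diff e) N.
Proof.
move=> [gA lind degd leibd _] line dege leibe DN.
have [grA bilA _ _] := gA; split=> // [|i x xi|i a b ai].
- exact: add_diff_linear.
- by apply: (gr_add grA); [apply: degd | apply: dege].
rewrite /= (leibd i a b ai) (leibe i a b ai) addrACA -scalerDr.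
by rewrite -(linear_propD (bilA.2 b)) -(linear_propD (bilA.1 a)).
Qed.

End AddDiff.

(** * Linear maps and products on a tensor product *)

Section TensorModule.
Context {k : fieldType} {V : lmodType k} {R : comFalgType k}.
Local Notation T := (tens V R).

Lemma tens_span_ind (Q : V -> Prop) (S : R -> Prop) (P : T -> Prop) :
    P 0 -> (forall x y, P x -> P y -> P (x + y)) ->
    (forall v r, Q v -> S r -> P (tpure v r)) ->
  forall x, tens_span Q S x -> P x.
Proof.
by move=> P0 PD Pp x [n [v [r [Qv Sr ->]]]]; apply: big_ind => // j _; apply: Pp.
Qed.

Lemma tens_ind (P : T -> Prop) :
    P 0 -> (forall x y, P x -> P y -> P (x + y)) ->
    (forall v r, P (tpure v r)) -> forall x, P x.
Proof. by move=> P0 PD Pp x; rewrite (tensE x); apply: big_ind. Qed.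

(** Pure tensors generate additively, so an additive map needs to be checked against scalars only on
    them. *)
Lemma tens_linear (W : lmodType R) (f : T -> W) :
    {morph f : x y / x + y} ->
    (forall s v r, f (tpure v (s * r)) = s *: f (tpure v r)) ->
  linear f.
Proof.
move=> fD fZ s x y; rewrite fD; congr (_ + _).
have f0 : f 0 = 0 by apply: (addrI (f 0)); rewrite -fD !addr0.
move: x; apply: tens_ind => [|x x' Hx Hx'|v r]; first by rewrite scaler0 f0 scaler0.
  by rewrite scalerDr !fD Hx Hx' scalerDr.
by rewrite scale_tpure fZ.
Qed.

Lemma tens_map_linear (f : V -> V) : linear f -> linear (tens_map f : T -> T).
Proof.
move=> linf; apply: tens_linear => [x y|s v r].
  rewrite -big_split; apply: eq_bigr => i _.
  by rewrite ffunE (linear_propD linf) tpureDl.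
by rewrite !tens_map_pure // scale_tpure.
Qed.

Lemma tens_map_iter (f : V -> V) n :
  linear f -> forall x : T, iter n (tens_map f) x = tens_map (iter n f) x.
Proof.
move=> linf; have linfn : linear (iter n f).
  by elim: n => //= n IH c x y; rewrite !iterS IH linf.
(* For n = 0 the right-hand side is the expansion of [x] in the basis of [R]. *)
move=> x; elim: n {linfn} x => [|n IH] x /=; first exact: tensE.
rewrite IH (linear_prop_sum (tens_map_linear _ linf)).
by apply: eq_bigr => i _; rewrite tens_map_pure.
Qed.

Section Mul.
Context {m : V -> V -> V}.
Hypotheses (linr : forall a, linear (m a)) (linl : forall a, linear (m^~ a)).
Local Notation M := (@tens_mul k V R m).

Lemma tens_mul_linearr (x : T) : linear (M x).
Proof.
have MD y : {morph M y : x z / x + z}.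
  move=> x' z; rewrite -big_split; apply: eq_bigr => i _.
  rewrite -big_split; apply: eq_bigr => j _.
  by rewrite ffunE (linear_propD (linr _)) tpureDl.
(* Additivity on the left suffices to reduce [x] to a pure tensor; linearity on the left is deduced
   afterwards, from linearity on the right. *)
have MDl y : {morph M^~ y : x z / x + z}.
  move=> x' z; rewrite -big_split; apply: eq_bigr => i _.
  rewrite -big_split; apply: eq_bigr => j _.
  by rewrite ffunE (linear_propD (linl _)) tpureDl.
have M0l y : M 0 y = 0 by apply: (addrI (M 0 y)); rewrite -MDl !addr0.
apply: tens_linear => [|s v r]; first exact: MD.
move: x; apply: tens_ind => [|x x' Hx Hx'|u t]; first by rewrite !M0l scaler0.
  by rewrite !MDl Hx Hx' scalerDr.
by rewrite !tens_mul_pure // scale_tpure mulrCA.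
Qed.

Lemma tens_mul_linearl (y : T) : linear (M^~ y).
Proof.
have MD x' : {morph M^~ x' : x z / x + z}.
  move=> x z; rewrite -big_split; apply: eq_bigr => i _.
  rewrite -big_split; apply: eq_bigr => j _.
  by rewrite ffunE (linear_propD (linl _)) tpureDl.
apply: tens_linear => [|s v r]; first exact: MD.
move: y; apply: tens_ind => [|y y' Hy Hy'|u t].
- by rewrite !(linear_prop0 (tens_mul_linearr _)) scaler0.
- by rewrite !(linear_propD (tens_mul_linearr _)) Hy Hy' scalerDr.
by rewrite !tens_mul_pure // scale_tpure mulrA.
Qed.

Lemma tens_mulA : associative m -> associative M.
Proof.
move=> mA x y z; move: x; apply: tens_ind => [|x x' Hx Hx'|u r].
- by rewrite !(linear_prop0 (tens_mul_linearl _)).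
- by rewrite !(linear_propD (tens_mul_linearl _)) Hx Hx'.
move: y; apply: tens_ind => [|y y' Hy Hy'|v s].
- rewrite (linear_prop0 (tens_mul_linearl _)) !(linear_prop0 (tens_mul_linearr _)).
  by rewrite (linear_prop0 (tens_mul_linearl _)).
- rewrite (linear_propD (tens_mul_linearl _)) !(linear_propD (tens_mul_linearr _)).
  by rewrite (linear_propD (tens_mul_linearl _)) Hy Hy'.
move: z; apply: tens_ind => [|z z' Hz Hz'|w t].
- by rewrite !(linear_prop0 (tens_mul_linearr _)).
- by rewrite !(linear_propD (tens_mul_linearr _)) Hz Hz'.
by rewrite !tens_mul_pure // mA mulrA.
Qed.

End Mul.
End TensorModule.

(** * Extension of scalars of a dga *)

Section TensorDga.
Context {k : fieldType} {A : predga k} {R : comFalgType k}.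
Local Notation T := (tens A R).
Local Notation B := (tens_dga A R).

(** The coordinates of v (x) r are multiples of [v]; conversely [x] is the sum of its coordinates
    tensored with the basis of [R]. Degrees can thus be checked coordinatewise. *)
Lemma tens_grP (i : int) (x : B) : graded_module A ->
  dga_gr i x <-> forall j, dga_gr i ((x : T) j).
Proof.
move=> grA; have [gr0 _ _ _] := grA; split.
  move: x; apply: tens_span_ind => [j|x y Hx Hy j|v r vi _ j]; rewrite ffunE //.
    exact: gr_add.
  exact: gr_scale.
move=> xi; exists (\dim {:R}), (fun j => (x : T) j), (fun j => (vbasis {:R})`_j).
by split=> //; apply: tensE.
Qed.

Lemma tens_graded_module : graded_module A -> graded_module B.
Proof.
move=> grA; have [gr0 _ dec indep] := grA; split.
- by move=> i; apply/tens_grP => // j; rewrite ffunE.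
- move=> i c x y /tens_grP xi /tens_grP yi; apply/tens_grP => // j.
  rewrite ffunE; apply: gr_add => //; last exact: yi.
  rewrite sum_ffunE; apply: gr_sum => // l; rewrite ffunE.
  by apply: gr_scale => //; apply: xi.
- apply: tens_ind => [|x x' [s [f [us fi ->]]] [s' [f' [us' fi' ->]]]|v r].
  + exists [::], (fun=> 0); split=> // [i|]; last by rewrite big_nil.
    by apply/tens_grP => // j; rewrite ffunE.
  (* Two decompositions are added after extending each by zero to the union of their index lists. *)
  + pose g (s : seq int) (f : int -> B) i := if i \in s then f i else 0.
    have gE t (h : int -> B) : uniq t -> {subset t <= undup (s ++ s')} ->
        \sum_(i <- t) h i = \sum_(i <- undup (s ++ s')) g t h i.
      move=> ut tu; rewrite -big_mkcond -big_filter /=; apply: perm_big.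
      apply: uniq_perm => // [|i]; first by rewrite filter_uniq ?undup_uniq.
      by rewrite mem_filter; case: (boolP (i \in t)) => // /tu ->.
    exists (undup (s ++ s')), (fun i => g s f i + g s' f' i).
    split=> [|i|]; first exact: undup_uniq.
      have gri t (h : int -> B) : (forall i, dga_gr i (h i)) ->
          forall j, dga_gr i ((g t h i : T) j).
        move=> hi j; rewrite /g; case: ifP => _; last by rewrite ffunE.
        by have /tens_grP := hi i; apply.
      apply/tens_grP => // j; rewrite ffunE.
      by apply: gr_add => //; apply: gri.
    by rewrite big_split -!gE // => i ii; rewrite mem_undup mem_cat ii ?orbT.
  + have [s [f [us fi ->]]] := dec v.
    exists s, (fun i => tpure (f i) r); split=> // [i|].
      by apply/tens_grP => // j; rewrite ffunE; apply: gr_scale.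
    apply/ffunP=> j; rewrite ffunE scaler_sumr sum_ffunE.
    by apply: eq_bigr => i _; rewrite ffunE.
(* Independence of the degrees is inherited from [A] in each coordinate. *)
- move=> s f us fi f0 i si; apply/ffunP => j; rewrite ffunE.
  apply: (indep s (fun i => (f i : T) j)) => // [l|].
    by have /tens_grP := fi l; apply.
  by have /ffunP/(_ j) := f0; rewrite sum_ffunE ffunE.
Qed.

Lemma tens_graded_algebra : graded_algebra A -> graded_algebra B.
Proof.
move=> [grA [linr linl] mA grM]; split.
- exact: tens_graded_module.
- by split=> x; [apply: tens_mul_linearr | apply: tens_mul_linearl].
- exact: tens_mulA.
move=> i j x y /tens_grP xi /tens_grP yj; apply/tens_grP => // l.
rewrite sum_ffunE; apply: gr_sum => // a; rewrite sum_ffunE; apply: gr_sum => // c.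
by rewrite ffunE; apply: gr_scale => //; apply: grM; [apply: xi | apply: yj].
Qed.

Lemma tens_leibniz1 : bilinear_mul A -> linear (@dga_d k A) ->
  leibniz1 (@dga_d k A) -> leibniz1 (@dga_d R B).
Proof.
move=> [linr linl] lind leib i a b ai.
have ML := tens_mul_linearl (R := R) linr linl.
have MR := tens_mul_linearr (R := R) linr linl.
have dL := tens_map_linear (R := R) _ lind.
move: a ai; apply: tens_span_ind => [|x y|v r vi _] /=.
- rewrite (linear_prop0 dL) !(linear_prop0 (ML _)) (linear_prop0 dL).
  by rewrite scaler0 addr0.
- move=> Hx Hy; rewrite (linear_propD dL) !(linear_propD (ML _)) (linear_propD dL).
  by rewrite Hx Hy scalerDr addrACA.
move: b; apply: tens_ind => [|x y|w s] /=.
- rewrite (linear_prop0 dL) !(linear_prop0 (MR _)) (linear_prop0 dL).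
  by rewrite scaler0 addr0.
- move=> Hx Hy; rewrite (linear_propD dL) !(linear_propD (MR _)) (linear_propD dL).
  by rewrite Hx Hy scalerDr addrACA.
rewrite !(tens_mul_pure, tens_map_pure) // (leib _ _ _ vi) tpureDl tpureZ scale_tpure.
(* One sign is a scalar of [k] acting on [R], the other an element of [R]; both depend only on the
   parity of the degree. *)
by rewrite -(signr_odd k) -(signr_odd R) scaler_sign mulr_sign.
Qed.

Lemma tens_ndga N : ndga A N -> ndga B N.
Proof.
move=> [gA lind degd leib dN]; have [grA bil _ _] := gA.
split=> [|||i a b ai|x].
- exact: tens_graded_algebra.
- exact: tens_map_linear.
- move=> i x /tens_grP xi; apply/tens_grP => // j; rewrite sum_ffunE.
  apply: gr_sum => // l; rewrite ffunE; apply: gr_scale => //.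
  by apply: degd; apply: xi.
- exact: tens_leibniz1.
rewrite [LHS]tens_map_iter // /tens_map big1 // => i _.
by rewrite dN; apply/ffunP => j; rewrite !ffunE scaler0.
Qed.

End TensorDga.

(** * Reduction modulo the maximal ideal *)

(** The quotient map followed by the isomorphism of R/R_+ with [k]; injectivity of the latter
    identifies the kernel. *)
Lemma residue_augmentation (k : fieldType) (R : comFalgType k) (Rp : idealr R) :
  residue_field_is Rp ->
  exists eps : {rmorphism R -> k},
    (forall c : k, eps c%:A = c) /\ forall r, (r \in Rp) = (eps r == 0).
Proof.
move=> [phi [bphi phiA]].
exists (phi \o \pi_({ideal_quot Rp})%qT : {rmorphism R -> k}).
split=> [|r]; first exact: phiA.
rewrite -[r in LHS]subr0 Quotient.idealrBE.
have phi0 : phi (\pi_({ideal_quot Rp})%qT 0) = 0.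
  by rewrite rmorph0 (rmorph0 phi).
by rewrite -[in RHS]phi0 /= (inj_eq (bij_inj bphi)).
Qed.

Section Reduction.
Context {k : fieldType} {A : predga k} {R : comFalgType k} {Rp : idealr R}.
Context {eps : {rmorphism R -> k}}.
Hypothesis epsA : forall c : k, eps c%:A = c.
Hypothesis epsP : forall r, (r \in Rp) = (eps r == 0).
Local Notation T := (tens A R).
Local Notation B := (tens_dga A R).

(** The map a (x) r |-> eps(r) a in coordinates; see [tens_eval_pure]. *)
Definition tens_eval (x : T) : A := \sum_(i < \dim {:R}) eps (vbasis {:R})`_i *: x i.

Lemma tens_evalD : {morph tens_eval : x y / x + y}.
Proof.
by move=> x y; rewrite -big_split; apply: eq_bigr => i _; rewrite ffunE scalerDr.
Qed.

Lemma tens_eval0 : tens_eval 0 = 0.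
Proof. by apply: (addrI (tens_eval 0)); rewrite -tens_evalD !addr0. Qed.

Lemma tens_eval_pure v r : tens_eval (tpure v r) = eps r *: v.
Proof.
rewrite [in RHS](basisE r) rmorph_sum scaler_suml; apply: eq_bigr => i _.
by rewrite ffunE scalerA -[in RHS]mulr_algl rmorphM epsA mulrC.
Qed.

Lemma tens_evalZ s (x : T) : tens_eval (s *: x) = eps s *: tens_eval x.
Proof.
move: x; apply: tens_ind => [|x y Hx Hy|v r].
- by rewrite scaler0 tens_eval0 scaler0.
- by rewrite scalerDr !tens_evalD Hx Hy scalerDr.
by rewrite scale_tpure !tens_eval_pure rmorphM scalerA.
Qed.

Lemma tens_eval_eq0 (x : T) : tens_eval x = 0 <-> ideal_act Rp x.
Proof.
split=> [x0|/asboolP[n [r [v [rRp ->]]]]].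
  apply/asboolP; exists (\dim {:R}).
  (* With b_i the basis of [R], x = \sum_i (b_i - eps(b_i)) (x_i (x) 1): the subtracted terms add up
     to (\sum_i eps(b_i) x_i) (x) 1, which vanishes by assumption. *)
  exists (fun i => (vbasis {:R})`_i - (eps (vbasis {:R})`_i)%:A).
  exists (fun i => tpure (x i) 1).
  split=> [i|]; first by rewrite epsP rmorphB epsA subrr.
  under eq_bigr => i _ do rewrite scalerBl !scale_tpure !mulr1 -tpureZ.
  rewrite sumrB -tensE -tpure_suml [X in tpure X]x0.
  by apply/ffunP=> j; rewrite !ffunE scaler0 subr0.
rewrite (big_morph _ tens_evalD tens_eval0) big1 // => i _.
by rewrite tens_evalZ (eqP (_ : eps (r i) == 0)) ?scale0r // -epsP.
Qed.

Lemma tens_evalM (m : A -> A -> A) (x y : T) :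
    (forall a, linear (m a)) -> (forall a, linear (m^~ a)) ->
  tens_eval (tens_mul m x y) = m (tens_eval x) (tens_eval y).
Proof.
move=> linr linl.
have ML := tens_mul_linearl (R := R) linr linl.
have MR := tens_mul_linearr (R := R) linr linl.
move: x; apply: tens_ind => [|x x' Hx Hx'|v r].
- by rewrite (linear_prop0 (ML _)) tens_eval0 (linear_prop0 (linl _)).
- by rewrite (linear_propD (ML _)) !tens_evalD Hx Hx' (linear_propD (linl _)).
move: y; apply: tens_ind => [|y y' Hy Hy'|w s].
- by rewrite (linear_prop0 (MR _)) tens_eval0 (linear_prop0 (linr _)).
- by rewrite (linear_propD (MR _)) !tens_evalD Hy Hy' (linear_propD (linr _)).
rewrite tens_mul_pure // !tens_eval_pure rmorphM (linear_propZ (linr _)).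
by rewrite (linear_propZ (linl _)) scalerA mulrC.
Qed.

Lemma tens_eval_map (f : A -> A) (x : T) : linear f ->
  tens_eval (tens_map f x) = f (tens_eval x).
Proof.
move=> linf; rewrite (linear_prop_sum linf) (big_morph _ tens_evalD tens_eval0).
by apply: eq_bigr => i _; rewrite tens_eval_pure (linear_propZ linf).
Qed.

(** [tens_eval] descends to the quotient, with inverse a |-> [a (x) 1]. It intertwines D with d_A
    because [e] takes values in A (x) R_+, where it vanishes. *)
Lemma add_diff_iso (e : B -> B) : ndga A 2 -> linear e ->
    (forall x, tens_span (fun=> True) (fun r => r \in Rp) (e x)) ->
  dga_iso (red_dga Rp (add_diff e)) A.
Proof.
move=> hA line eRp; have [gA lind _ _ _] := hA.
have [grA [linr linl] _ _] := gA.
have [[_ _ _ _] bilB _ _] := tens_graded_algebra (R := R) gA.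
pose C : predga R := add_diff e.
have linD : linear (@dga_d R C).
  exact: (@add_diff_linear R B e (tens_map_linear _ lind) line).
have e0 x : tens_eval (e x) = 0.
  move: (e x) (eRp x); apply: tens_span_ind => [|y z Hy Hz|v r _].
  - exact: tens_eval0.
  - by rewrite tens_evalD Hy Hz addr0.
  by rewrite epsP tens_eval_pure => /eqP->; rewrite scale0r.
pose f (x : red_dga Rp C) : A := tens_eval (red_repr x).
have tens_evalB (x y : T) : tens_eval (x - y) = tens_eval x - tens_eval y.
  by apply/eqP; rewrite eq_sym subr_eq -tens_evalD subrK.
(* Independence of the chosen representative. *)
have fpi (x : T) : f (red_pi Rp (x : C)) = tens_eval x.
  apply/eqP; rewrite -subr_eq0 -tens_evalB; apply/eqP/tens_eval_eq0.
  by apply: (proj1 (@red_piP k R Rp C _ _)); rewrite red_reprK.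
have piP (x : red_dga Rp C) : exists y : T, x = red_pi Rp (y : C).
  by exists (red_repr x); rewrite red_reprK.
have linf : linear f.
  move=> c x y; have [x' ->] := piP x; have [y' ->] := piP y.
  rewrite [c *: _]red_scale_pi -red_piD !fpi tens_evalD.
  by rewrite (tens_evalZ c%:A x') epsA.
have fK : cancel f (fun a => red_pi Rp (tpure a 1 : C)).
  move=> x; have [x' ->] := piP x; rewrite fpi; apply/red_piP/tens_eval_eq0.
  by rewrite tens_evalB tens_eval_pure rmorph1 scale1r subrr.
have Kf : cancel (fun a => red_pi Rp (tpure a 1 : C)) f.
  by move=> a; rewrite fpi tens_eval_pure rmorph1 scale1r.
pose fL : {linear red_dga Rp C -> A} :=
  HB.pack f (GRing.isLinear.Build k (red_dga Rp C) A *:%R f linf).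
exists fL; split=> [|x y|i x|x].
- by exists (fun a => red_pi Rp (tpure a 1 : C)).
- have [x' ->] := piP x; have [y' ->] := piP y.
  rewrite red_mul_pi; last exact: bilB.
  by rewrite /= !fpi tens_evalM.
- split=> [[y /tens_grP yi ->]|fxi] /=.
    rewrite fpi; apply: gr_sum => // j; apply: gr_scale => //.
    exact: yi.
  (* A class whose image has degree i is represented by that image tensored with 1, which has degree
     i. *)
  exists (tpure (f x) 1); last by rewrite fK.
  by apply/tens_grP => // j; rewrite ffunE; apply: gr_scale.
have [x' ->] := piP x; rewrite red_d_pi //= !fpi.
by rewrite tens_evalD e0 addr0 tens_eval_map.
Qed.

End Reduction.

(** * Powers of d_A + e and the equivalence *)

Lemma iter_square (U : Type) (f g : U -> U) : f =1 g \o g ->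
  forall n x, iter n.*2 g x = iter n f x.
Proof. by move=> fE; elim=> //= n IH x; rewrite IH fE. Qed.

Theorem theorem16 (k : fieldType) (A : predga k) (hA : ndga A 2)
    (R : comFalgType k) (Rp : idealr R)
    (hloc : local_with Rp) (hres : residue_field_is Rp)
    (N : nat) (hN : (2 <= N)%N)
    (e : tens_dga A R -> tens_dga A R) (he : der1_plus Rp e) :
  let F := dEnd 1 e \+ (e \o e) in
  N_deformation Rp N A (add_diff e) <->
  if odd N
  then forall x, iter ((N - 1) %/ 2) F ((@dga_d R (tens_dga A R) \+ e) x) = 0
  else forall x, iter (N %/ 2) F x = 0.
Proof.
move=> F; have [line dege eRp leibe] := he.
have hB := tens_ndga (R := R) 2 hA; have [_ lind _ _ d2] := hB.
set D := @dga_d R (tens_dga A R) \+ e.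
have FE : F =1 D \o D.
  have /= dD := linear_propD lind.
  (* As [e] has degree 1, d_End(e) = d_A e + e d_A, the cross terms of (d_A + e)^2; the term d_A^2
     is zero. *)
  move=> x; rewrite /F /D /dEnd /= expr1 scaleN1r opprK dD.
  have /= -> := d2 x; rewrite add0r (linear_propD line).
  by rewrite addrA.
have iterE x : iter N D x =
    if odd N then iter ((N - 1) %/ 2) F (D x) else iter (N %/ 2) F x.
  rewrite !divn2 -!(iter_square _ _ _ FE) subn1.
  case: ifP => oN; last by rewrite even_halfK // oN.
  (* For odd [N] the number N - 1 is even, and the remaining factor [D] is the one applied first. *)
  by rewrite -iterSr even_halfK ?prednK // ?(leq_trans _ hN) //; case: (N) oN hN.
suff defP : N_deformation Rp N A (add_diff e) <-> forall x, iter N D x = 0.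
  apply: (iff_trans defP); move: iterE.
  by case: (odd N) => iterE; split=> H x; have := H x; rewrite iterE.
(* Forwards, D^N = 0 is one of the axioms of an N-dga; backwards, the other axioms and the
   isomorphism with [A] are supplied by the lemmas above. *)
split=> [[[_ _ _ _ DN] _]|DN]; first exact: DN.
split; last first.
  have [eps [epsA epsP]] := residue_augmentation _ _ _ hres.
  exact: (add_diff_iso epsA epsP).
exact: add_diff_ndga hB line dege leibe DN.
Qed.
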